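(* Let $\bar x\in\mathcal R=\{x\in S:\ G(x)\subseteq C\}$ be a local weakly efficient solution to the vector optimization problem of minimizing $f$ (with respect to the cone $K$) over $\mathcal R$. Suppose that: (i) $f$ is $B$-differentiable at $\bar x$; (ii) $G$ is lower semicontinuous in a neighbourhood of $\bar x$ and is metrically $C$-increasing around $\bar x$, relative to $S$; (iii) $G$ admits $H_G(\bar x;\cdot):\mathbb X\rightrightarrows\mathbb Z$ as an outer prederivative at $\bar x$. Then $$\mathrm D_Bf(\bar x;v)\notin-\mathrm{int}\,K,\qquad\forall v\in H_G(\bar x;\cdot)^{+1}(C)\cap \mathrm I_{\mathrm w}(S;\bar x).$$ If, in addition, (iv) $\mathrm D_Bf(\bar x;\cdot):\mathbb X\to\mathbb Y$ is $K$-convexlike on the set $H_G(\bar x;\cdot)^{+1}(C)\cap \mathrm T(S;\bar x)$; (v) $H_G(\bar x;\mathbf 0)\subseteq C$; (vi) $H_G(\bar x;\cdot)$ is Lipschitz, then there exists $y^*\in K^{\oplus}\setminus\{\mathbf 0^*\}$ such that $$\langle y^*,\mathrm D_Bf(\bar x;v)\rangle\ge0,\qquad\forall v\in H_G(\bar x;\cdot)^{+1}(C)\cap \mathrm T(S;\bar x).$$ In particular, whenever $f$ is Fréchet differentiable at $\bar x$ (with Fréchet derivative $\mathrm Df(\bar x)$), it results in $$-\mathrm Df(\bar x)^*y^*\in\bigl[H_G(\bar x;\cdot)^{+1}(C)\cap \mathrm T(S;\bar x)\bigr]^{\ominus}.$$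
   Context: Setting: $\mathbb X,\mathbb Y,\mathbb Z$ are real Banach spaces; $K\subseteq\mathbb Y$ is a (proper) convex cone with $\mathrm{int}\,K\neq\varnothing$, inducing the partial order $y_1\le_K y_2\iff y_2-y_1\in K$; $C\subseteq\mathbb Z$ is a proper closed convex cone, $C\neq\{\mathbf 0\}$; $S\subseteq\mathbb X$ is nonempty and closed; $f:\mathbb X\to\mathbb Y$ is a mapping; $G:\mathbb X\rightrightarrows\mathbb Z$ is a set-valued mapping with $G(x)\neq\varnothing$ for every $x\in\mathbb X$. $\mathrm B(x,r)$ is the closed ball with center $x$ and radius $r$, and $\mathbb B$ is the closed unit ball centered at $\mathbf 0$. For a set $A$, $\mathrm B(A,r)=\{z:\ \mathrm{dist}(z,A)\le r\}$ is its $r$-enlargement. $\mathbf 0^*$ is the null vector of a dual space. For a cone $Q$ in a Banach space, $Q^{\oplus}=\{q^*:\ \langle q^*,q\rangle\ge0,\ \forall q\in Q\}$ and $Q^{\ominus}=-Q^{\oplus}$. $\Lambda^*$ denotes the adjoint of a bounded linear operator $\Lambda$. Local weak efficiency: $\bar x\in\mathcal R$ is a local weakly efficient solution to the problem of minimizing $f$ over $\mathcal R$ if there is $\delta>0$ with $f(\mathcal R\cap \mathrm B(\bar x,\delta))\cap[f(\bar x)-\mathrm{int}\,K]=\varnothing$. $f$ is $B$-differentiable at $\bar x$ if there is a positively homogeneous and continuous mapping $\mathrm D_Bf(\bar x;\cdot):\mathbb X\to\mathbb Y$ (the $B$-derivative) with $\lim_{x\to\bar x}\frac{f(x)-f(\bar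 x)-\mathrm D_Bf(\bar x;x-\bar x)}{\|x-\bar x\|}=0$. A mapping $h:\mathbb X\to\mathbb Y$ is $K$-convexlike on a set $A$ if $h(A)+K$ is convex. $G$ is lower semicontinuous (l.s.c.) at $x$ if for every open $V$ with $V\cap G(x)\ne\varnothing$ there is a neighbourhood $U$ of $x$ with $G(u)\cap V\neq\varnothing$ for all $u\in U$. $G$ is metrically $C$-increasing around $\bar x$, relative to $S$, if there exist $\delta>0$ and $\alpha>1$ such that for all $x\in \mathrm B(\bar x,\delta)\cap S$ and $r\in(0,\delta)$ there is $z\in \mathrm B(x,r)\cap S$ with $\mathrm B(G(z),\alpha r)\subseteq \mathrm B(G(x)+C,r)$. A set-valued mapping $H$ is positively homogeneous if $H(tv)=tH(v)$ for all $t>0$ and all $v$. A positively homogeneous set-valued mapping $H_G(\bar x;\cdot):\mathbb X\rightrightarrows\mathbb Z$ is an outer prederivative of $G$ at $\bar x$ if for every $\epsilon>0$ there is $\delta>0$ with $G(x)\subseteq G(\bar x)+H_G(\bar x;x-\bar x)+\epsilon\|x-\bar x\|\mathbb B$ for all $x\in \mathrm B(\bar x,\delta)$. $H_G(\bar x;\cdot)^{+1}(C)=\{v\in\mathbb X:\ H_G(\bar x;v)\subseteq C\}$. A set-valued mapping $H$ is Lipschitz if for some $l\ge 0$ one has $\mathrm{haus}(H(x_1),H(x_2))\le l\|x_1-x_2\|$ for all $x_1,x_2\in\mathbb X$, where $\mathrm{haus}$ is the Hausdorff distance $\mathrm{haus}(A,W)=\max\{\sup_{a\in A}\mathrm{dist}(a,W),\sup_{w\in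 W}\mathrm{dist}(w,A)\}$. Contingent cone: $\mathrm T(S;\bar x)=\{v\in\mathbb X:\ \exists v_n\to v,\ \exists t_n\downarrow0:\ \bar x+t_nv_n\in S\ \forall n\in\mathbb N\}$. Weak feasible direction cone: $\mathrm I_{\mathrm w}(S;\bar x)=\{v\in\mathbb X:\ \forall\epsilon>0\ \exists t_\epsilon\in(0,\epsilon):\ \bar x+t_\epsilon v\in S\}$. *)

(* Defs.v *)
From HB Require Import structures.
From mathcomp Require Import all_boot all_order all_algebra.
From mathcomp Require Import all_classical all_reals all_analysis.

Set Implicit Arguments.
Unset Strict Implicit.
Unset Printing Implicit Defensive.

Import Order.TTheory GRing.Theory Num.Theory.
Import numFieldNormedType.Exports.

Local Open Scope classical_set_scope.
Local Open Scope ring_scope.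

Section Sets.
Context {R : realType} {V : normedModType R}.
Implicit Types (A B : set V).

Definition set_add A B : set V := [set a + b | a in A & b in B].

Definition set_scale (t : R) A : set V := [set t *: a | a in A].

(* The norm ball {y | `|x - y| <= r}; the library's [closed_ball] is the closure
   of the open ball, which is empty for r = 0. *)
Definition cball (x : V) (r : R) : set V := closed_ball_ Num.norm x r.

(* Distances are extended-real: dist(z, set0) = +oo. *)
Definition enlargement A (r : R) : set V :=
  [set z | (edist_inf A z <= r%:E)%E].

Definition haus A B : \bar R :=
  maxe (ereal_sup [set edist_inf B a | a in A])
       (ereal_sup [set edist_inf A b | b in B]).

(* Every cone contains 0, so that the induced relation is reflexive. *)
Definition is_cone A : Prop :=
  A !=set0 /\ forall (t : R) a, 0 <= t -> A a -> A (t *: a).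

Definition proper_convex_cone A : Prop :=
  [/\ is_cone A, convex_set A & A <> setT].

Definition contingent_cone A (x : V) : set V :=
  [set v | exists (v_ : nat -> V) (t_ : nat -> R),
     [/\ v_ @ \oo --> v, forall n, 0 < t_ n, t_ @ \oo --> (0 : R)
       & forall n, A (x + t_ n *: v_ n)]].

Definition weak_feasible_cone A (x : V) : set V :=
  [set v | forall e : R, 0 < e ->
     exists t : R, [/\ 0 < t, t < e & A (x + t *: v)]].

(* The dual space, as a set of functions; <q, x> is the application q x. *)
Definition topological_dual : set (V -> R^o) :=
  [set q | linear q /\ continuous q].

Definition pos_polar A : set (V -> R^o) :=
  [set q | topological_dual q /\ forall x, A x -> 0 <= q x].

Definition neg_polar A : set (V -> R^o) := [set - q | q in pos_polar A].

End Sets.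

Definition adjoint {R : realType} {V W : normedModType R} (L : V -> W)
  (q : W -> R^o) : V -> R^o := q \o L.

Section Mappings.
Context {R : realType} {X Y : normedModType R}.

Definition local_weakly_efficient (f : X -> Y) (K : set Y) (D : set X)
    (xbar : X) : Prop :=
  D xbar /\
  exists2 d : R, 0 < d &
    (f @` (D `&` cball xbar d)) `&` [set f xbar - k | k in interior K] = set0.

(* [D] is the B-derivative of [f] at [xbar]. *)
Definition is_B_derivative (f : X -> Y) (xbar : X) (D : X -> Y) : Prop :=
  [/\ forall (t : R) v, 0 < t -> D (t *: v) = t *: D v,
      continuous D
    & `|x - xbar|^-1 *: (f x - f xbar - D (x - xbar)) @[x --> xbar^'] -->
      (0 : Y)].

Definition convexlike (K : set Y) (h : X -> Y) (A : set X) : Prop :=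
  convex_set (set_add (h @` A) K).

End Mappings.

Section SetValuedMappings.
Context {R : realType} {X Z : normedModType R}.
Implicit Types (G H : X -> set Z) (C : set Z).

Definition lsc_at G (x : X) : Prop :=
  forall V : set Z, open V -> V `&` G x !=set0 ->
    \forall u \near x, G u `&` V !=set0.

Definition metrically_increasing C (S : set X) G (xbar : X) : Prop :=
  exists d a : R, [/\ 0 < d, 1 < a &
    forall x (r : R), cball xbar d x -> S x -> 0 < r -> r < d ->
      exists z, [/\ cball x r z, S z &
        enlargement (G z) (a * r) `<=` enlargement (set_add (G x) C) r]].

Definition pos_homogeneous H : Prop :=
  forall (t : R) v, 0 < t -> H (t *: v) = set_scale t (H v).

Definition outer_prederivative G (xbar : X) H : Prop :=
  pos_homogeneous H /\
  forall e : R, 0 < e -> exists2 d : R, 0 < d &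
    forall x, cball xbar d x ->
      G x `<=` set_add (set_add (G xbar) (H (x - xbar)))
                       (set_scale (e * `|x - xbar|) (cball 0 1)).

Definition upper_inverse H C : set X := [set v | H v `<=` C].

Definition haus_lipschitz H : Prop :=
  exists2 l : R, 0 <= l &
    forall x1 x2, (haus (H x1) (H x2) <= (l * `|x1 - x2|)%:E)%E.

End SetValuedMappings.

(* Main.v *)
Require Import Defs.
From HB Require Import structures.
From mathcomp Require Import all_boot all_order all_algebra.
From mathcomp Require Import all_classical all_reals all_analysis.
From mathcomp Require Import ring lra.

Import Order.TTheory GRing.Theory Num.Theory.
Import numFieldNormedType.Exports.

Local Open Scope classical_set_scope.
Local Open Scope ring_scope.

(* If [G x] lies in the [r]-enlargement of [C], then metric [C]-increase at
   radius [r / (a - 1)] yields [z] such that the [s]-enlargement of [G z] lies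
   in the [s]-enlargement of the closed convex set [C], with [s = a r / (a - 1)],
   and this forces [G z] into [C].  Hence the distance from [x] to the feasible
   set is at most [r / (a - 1)].  Along a tangent direction [v] with [HG v] in
   [C], the outer prederivative makes [r = o(t)], so [xbar + t v] can be
   corrected to a feasible point within [o(t)], and [DBf v \in - int K] would
   contradict weak efficiency.  The multiplier separates the convex cone
   [DBf(A) + K] from [- int K]. *)

(** * Enlargements, convex cones and interiors *)

Lemma enlargementP {R : realType} {V : normedModType R} {A : set V} (r : R) z :
  enlargement A r z <->
  forall e, 0 < e -> exists2 a, A a & `|z - a| < r + e.
Proof.
split=> [Az e e0|Az].
  have : (edist_inf A z < (r + e)%:E)%E.
    by apply: le_lt_trans Az _; rewrite lte_fin ltrDl.
  case/ereal_inf_lt => _ [a Aa <-] /edist_lt_ball /=.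
  by rewrite -ball_normE /= => ?; exists a.
apply/lee_addgt0Pr => e e0; have [a Aa za] := Az _ e0.
rewrite -EFinD; apply: (@le_trans _ _ (edist (z, a))).
  by apply: ereal_inf_lbound; exists a.
apply: edist_fin => /=; last by rewrite -ball_normE.
exact: le_lt_trans za.
Qed.

Lemma sub_enlargement {R : realType} {V : normedModType R} {A : set V}
  (r s : R) : r <= s -> enlargement A r `<=` enlargement A s.
Proof. by move=> rs z /le_trans; apply; rewrite lee_fin. Qed.

Lemma convex_setP {R : realType} {V : normedModType R} {A : set V} a b (t : R) :
  convex_set A -> 0 <= t -> t <= 1 -> A a -> A b -> A (t *: a + (1 - t) *: b).
Proof.
move=> cA t0 t1 Aa Ab.
have t01 : Itv.spec (@Itv.num_sem R)
    (Itv.Real `[0%Z, 1%Z]) t.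
  by rewrite /Itv.spec /= /Itv.num_sem/= in_itv/= num_real t0 t1.
by have := cA a b (Itv.mk t01) (mem_set Aa) (mem_set Ab) => /set_mem.
Qed.

Lemma convex_cone_add {R : realType} {V : normedModType R} {A : set V} a b :
  is_cone A -> convex_set A -> A a -> A b -> A (a + b).
Proof.
move=> [_ coneA] cA Aa Ab.
have := convex_setP a b 2^-1 cA _ _ Aa Ab.
have h : 2^-1 = 1 - 2^-1 :> R by lra.
rewrite -h -scalerDr => /(_ _ _)/(coneA 2); rewrite scalerA divff// scale1r.
by apply => //; lra.
Qed.

Lemma closed_approx {R : realType} {V : normedModType R} {A : set V} y :
  closed A -> (forall e, 0 < e -> exists2 a, A a & `|y - a| < e) -> A y.
Proof.
move=> clA Ay; apply: clA => B /nbhs_ballP[e /= e0 yB].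
have [a Aa ya] := Ay _ e0; exists a; split=> //.
by apply: yB; rewrite -ball_normE.
Qed.

Lemma interior_normP {R : realType} {V : normedModType R} {A : set V} y :
  interior A y <-> exists2 r : R, 0 < r & forall z, `|y - z| < r -> A z.
Proof.
split=> [/nbhs_ballP[r /= r0 yA]|[r r0 yA]].
  by exists r => // z yz; apply: yA; rewrite -ball_normE.
by apply/nbhs_ballP; exists r => // z; rewrite -ball_normE; exact: yA.
Qed.

(* If a point [y] had distance [d > 0] to [C], moving it by [s] away from an
   almost nearest point of [C] would, by convexity of the distance function,
   bring the distance above [s]. *)
Lemma cball_sub_enlargement {R : realType} {V : normedModType R} {C : set V}
  (y : V) (s : R) : closed C -> convex_set C -> 0 < s ->
  cball y s `<=` enlargement C s -> C y.
Proof.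
move=> clC cC s0 ysC; apply: closed_approx => // e0 e0_gt0.
apply: contrapT => /forall2NP far.
have ysy : cball y s y by rewrite /cball /closed_ball_ /= subrr normr0 ltW.
have /enlargementP/(_ 1 ltr01)[c0 Cc0 _] := ysC _ ysy.
pose D := [set `|y - c| | c in C].
have lbD : lbound D e0.
  move=> _ [c Cc <-]; rewrite leNgt; apply/negP => lt.
  by case: (far c).
have D0 : D !=set0 by exists `|y - c0|; exists c0.
have infD : has_inf D by split => //; exists e0.
have dD c : C c -> inf D <= `|y - c|.
  by move=> Cc; apply: ge_inf; [exists e0|exists c].
set d := inf D in dD.
have d0 : 0 < d by apply: lt_le_trans e0_gt0 _; exact: lb_le_inf.
(* The tolerance [d ^+ 2 / s] gives [s * (n - d) < d ^+ 2 <= d * n], which makes [e] below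
   positive. *)
have /inf_adherent/(_ infD)[_ [c Cc <-]] : 0 < d ^+ 2 / s.
  by rewrite divr_gt0 ?exprn_gt0.
rewrite -/d; set n := `|y - c| => nd.
have dn : d <= n := dD c Cc.
have n0 : 0 < n by exact: lt_le_trans dn.
have sn0 : 0 < s + n by lra.
have nds : (n - d) * s < d ^+ 2 by rewrite -ltr_pdivlMr// ltrBlDl.
(* [u] lies on the ray from [c] through [y], at distance [s] beyond [y]; with [m] below,
   [y = m *: u + (1 - m) *: c]. *)
pose u := y + (s / n) *: (y - c).
have yu : cball y s u.
  rewrite /cball /closed_ball_ /= /u opprD addNKr normrN normrZ -/n.
  have sn : 0 <= s / n by rewrite divr_ge0 // ltW.
  by rewrite ger0_norm // divfK ?gt_eqF.
(* [e] solves [m * (s + e) = d], so a point [c'] closer to [u] than [s + e] puts a convex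
   combination of [c'] and [c] nearer to [y] than [d]. *)
pose e := (d * n - s * (n - d)) / n.
have e_gt0 : 0 < e by rewrite divr_gt0 // /e subr_gt0; nra.
have /enlargementP/(_ _ e_gt0)[c' Cc' uc'] := ysC _ yu.
pose m := n / (s + n).
have m0 : 0 <= m by rewrite divr_ge0 ?ltW.
have m1 : m <= 1 by rewrite ler_pdivrMr // mul1r; lra.
have := dD _ (convex_setP _ _ _ cC m0 m1 Cc' Cc).
have -> : y - (m *: c' + (1 - m) *: c) = m *: (u - c').
  have -> : m *: (u - c') = m *: y + (1 - m) *: (y - c) - m *: c'.
    rewrite /u scalerBr scalerDr scalerA; congr (_ + _ *: _ - _).
    by rewrite /m; field; rewrite !gt_eqF.
  rewrite [(1 - m) *: (y - c)]scalerBr addrA -scalerDl subrKC scale1r opprD.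
  by rewrite addrA addrAC.
rewrite normrZ ger0_norm // leNgt => /negP; apply.
apply: lt_le_trans (_ : m * (s + e) <= _).
  by rewrite ltr_pM2l // divr_gt0.
rewrite /m /e le_eqVlt; apply/orP; left; apply/eqP; field.
by rewrite !gt_eqF.
Qed.

(** * Distance to the feasible set *)

(** At radius [rho = r / (a - 1)] the inflated radius [a * rho] equals [r + rho]: [rho] from metric
    increase plus [r] from [G x] to [C]. Enlargements of [G z] and [C] by the same amount can then
    be cancelled, as [C] is closed and convex. *)
Lemma increasing_error_bound {R : realType} {X Z : normedModType R}
    {C : set Z} {S : set X} {G : X -> set Z} {xbar : X} :
  is_cone C -> convex_set C -> closed C -> metrically_increasing C S G xbar ->
  exists d k : R, [/\ 0 < d, 0 < k & forall x (r : R), cball xbar d x -> S x ->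
    0 < r -> r < d -> G x `<=` enlargement C r ->
    exists z, [/\ S z, G z `<=` C & `|x - z| <= k * r]].
Proof.
move=> coneC cC clC [d [a [d0 a1 Gincr]]].
have a10 : 0 < a - 1 by rewrite subr_gt0.
(* The bound [r < d * (a - 1)] keeps the radius [r / (a - 1)] below [d], as metric increase
   requires. *)
exists (Num.min d (d * (a - 1))), (a - 1)^-1; split.
- by rewrite lt_min d0 mulr_gt0.
- by rewrite invr_gt0.
move=> x r; rewrite /cball /closed_ball_ /= le_min lt_min.
move=> /andP[xd _] Sx r0 /andP[_ rd] GxC.
have [||z [xz Sz GzGx]] := Gincr x (r / (a - 1)) xd Sx.
- by rewrite divr_gt0.
- by rewrite ltr_pdivrMr.
have arE : a * (r / (a - 1)) = r + r / (a - 1) by field; rewrite gt_eqF.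
have ar0 : 0 < a * (r / (a - 1)) by rewrite arE addr_gt0 ?divr_gt0.
exists z; split=> // [y Gzy|]; last by rewrite mulrC.
apply: (cball_sub_enlargement _ _ clC cC ar0) => u yu.
have /GzGx : enlargement (G z) (a * (r / (a - 1))) u.
  apply/enlargementP => e e0; exists y => //.
  by rewrite distrC (le_lt_trans yu)// ltrDl.
move=> /enlargementP uGx; apply/enlargementP => e e0.
have e20 : 0 < e / 2 by lra.
have [_ [g Gxg [c Cc <-]] ugc] := uGx _ e20.
have /enlargementP/(_ _ e20)[c' Cc' gc'] := GxC g Gxg.
exists (c' + c); first exact: convex_cone_add.
have -> : u - (c' + c) = (u - (g + c)) + (g - c').
  by rewrite !opprD !addrA; rewrite (addrAC _ (- c) g) subrK addrAC.
by rewrite arE (le_lt_trans (ler_normD _ _))//; lra.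
Qed.

(** * First-order expansion and weak efficiency *)

Lemma B_derivative0 {R : realType} {X Y : normedModType R} {f : X -> Y}
  {x : X} {D : X -> Y} : is_B_derivative f x D -> D 0 = 0.
Proof.
move=> [homD _ _]; have := homD 2 0 (ltr0Sn _ 1); rewrite scaler0 => D2.
by apply: (addIr (D 0)); rewrite add0r {3}D2 scaler_nat mulr2n.
Qed.

Lemma B_derivative_remainder {R : realType} {X Y : normedModType R}
    {f : X -> Y} {x : X} {D : X -> Y} (e : R) :
  is_B_derivative f x D -> 0 < e ->
  exists2 d : R, 0 < d & forall z, `|z - x| < d ->
    `|f z - f x - D (z - x)| <= e * `|z - x|.
Proof.
move=> fD e0; have D0 := B_derivative0 fD; have [_ _] := fD.
move=> /cvgr0Pnorm_le /(_ _ e0).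
move=> /nbhs_ballP[d /= d0 xd]; exists d => // z zx.
(* The limit is over a punctured neighbourhood; at [z = x] the bound rests on [D 0 = 0]. *)
have [->|zNx] := eqVneq z x; first by rewrite !subrr D0 subrr !normr0 mulr0.
have zx0 : 0 < `|z - x| by rewrite normr_gt0 subr_eq0.
have := xd z; rewrite -ball_normE /= distrC => /(_ zx zNx).
by rewrite normrZ ger0_norm ?invr_ge0// mulrC ler_pdivrMr.
Qed.

Lemma interior_cone_scale {R : realType} {V : normedModType R} {A : set V}
  (t : R) k : is_cone A -> 0 < t -> interior A k -> interior A (t *: k).
Proof.
move=> [_ coneA] t0 /interior_normP[r r0 kA]; apply/interior_normP.
exists (t * r) => [|z]; first exact: mulr_gt0.
rewrite -[z](scalerKV (lt0r_neq0 t0)) -scalerBr normrZ gtr0_norm// ltr_pM2l//.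
by move=> /kA; apply: coneA; exact: ltW.
Qed.

Lemma interior_cone_add {R : realType} {V : normedModType R} {A : set V} k a :
  is_cone A -> convex_set A -> interior A k -> A a -> interior A (k + a).
Proof.
move=> coneA cA /interior_normP[r r0 kA] Aa; apply/interior_normP.
exists r => // z kz; rewrite -(subrK a z); apply: convex_cone_add => //.
by apply: kA; rewrite opprB addrA.
Qed.

(** The hypothesis on [v] is shaped to serve both cones: weak feasible directions take [w = v],
    while contingent ones take a nearby [w] whose image [HG w] leaves [C] only by a Lipschitz
    error. *)
Lemma B_derivative_notin_opp_interior {R : realType} {X Y Z : normedModType R}
    (K : set Y) (C : set Z) (S : set X) (f : X -> Y) (G : X -> set Z)
    (xbar : X) (DBf : X -> Y) (HG : X -> set Z) (v : X) :
  is_cone K -> is_cone C -> convex_set C -> closed C ->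
  local_weakly_efficient f K [set x | S x /\ G x `<=` C] xbar ->
  is_B_derivative f xbar DBf ->
  metrically_increasing C S G xbar -> outer_prederivative G xbar HG ->
  (forall e : R, 0 < e -> exists (t : R) w, [/\ 0 < t, t < e, `|v - w| < e,
     S (xbar + t *: w) & HG w `<=` enlargement C e]) ->
  ~ [set - k | k in interior K] (DBf v).
Proof.
move=> coneK coneC cC clC [[_ Gxbar] [d1 d10 eff]] fD Gincr [homH predG] vS.
move=> [k Kk Dv].
have [homD cD _] := fD.
have /interior_normP[rho rho0 kK] := Kk.
have rho20 : 0 < rho / 2 by lra.
have /cvgrPdist_lt/(_ _ rho20)/nbhs_ballP[d2 /= d20 vD] := cD v.
pose m := `|v| + 1.
have m0 : 0 < m by rewrite /m ltr_wpDl.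
have /(B_derivative_remainder _ fD)[d3 d30 fx] : 0 < rho / (2 * m).
  by rewrite divr_gt0 // mulr_gt0.
have [d4 [ka [d40 ka0 errb]]] := increasing_error_bound coneC cC clC Gincr.
(* [e * M] collects the errors on the direction: [e] from [w] near [v], and [ka * (e * (1 + m))]
   from the correction to a feasible point. *)
pose M := 1 + ka * (1 + m).
have m10 : 0 < 1 + m by lra.
have M0 : 0 < M by rewrite addr_gt0// mulr_gt0.
pose e := Num.min 1 (Num.min d2 1 / (2 * M)).
have mi0 : 0 < Num.min d2 1 by rewrite lt_min d20 ltr01.
have M20 : 0 < 2 * M by lra.
have e0 : 0 < e by rewrite lt_min ltr01 divr_gt0.
have eM : e * M < Num.min d2 1.
  have : e * (2 * M) <= Num.min d2 1.
    by rewrite -ler_pdivlMr// ge_min lexx orbT.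
  nra.
have e1 : e <= 1 by rewrite ge_min lexx.
clearbody e.
have [d5 d50 predGe] := predG _ e0.
(* [e'] is chosen after [e] because [d5] depends on [e]; it makes [t] so small that the points used
   stay in the balls of radii [d1], [d3], [d4], [d5]. *)
pose e' := Num.min e (Num.min (Num.min d1 d3 / (2 * m))
  (Num.min (d4 / (2 * (1 + m))) (d5 / (2 * m)))).
have m20 : 0 < 2 * m by lra.
have m120 : 0 < 2 * (1 + m) by lra.
have e'0 : 0 < e'.
  by rewrite !lt_min e0 !(divr_gt0 _ m120, divr_gt0 _ m20)// lt_min d10.
have [t [w [t0 te' vw Sw HwC]]] := vS _ e'0.
have e'e : e' <= e by rewrite ge_min lexx.
have te : t < e by exact: lt_le_trans e'e.
have vwe : `|v - w| < e by exact: lt_le_trans e'e.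
have wm : `|w| <= m.
  by rewrite -(subKr v w) (le_trans (ler_normB _ _))// lerD2l; lra.
have tm2 c : e' <= c / (2 * m) -> 0 < c -> t * m < c.
  move=> ec c0; have : t <= c / (2 * m) by rewrite (le_trans _ ec) // ltW.
  by rewrite ler_pdivlMr// mulrCA; lra.
have td1 : t * m < Num.min d1 d3.
  by apply: tm2; rewrite ?lt_min ?d10 // /e' !ge_min lexx !orbT.
have td5 : t * m < d5.
  by apply: tm2; rewrite // /e' !ge_min lexx !orbT.
have td4 : t * (1 + m) < d4.
  have : t <= d4 / (2 * (1 + m)).
    by rewrite (le_trans (ltW te')) // /e' !ge_min lexx !orbT.
  by rewrite ler_pdivlMr// mulrCA; lra.
move: td1; rewrite lt_min => /andP[td1 td3].
have ntw : `|t *: w| <= t * m by rewrite normrZ gtr0_norm// ler_pM2l.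
have xw : xbar + t *: w - xbar = t *: w by rewrite addrC addKr.
(* The part [t * e] comes from [HG w] scaled by [t], the part [t * (e * m)] from the remainder of
   the outer prederivative. *)
pose eta := t * (e * (1 + m)).
have eta0 : 0 < eta by rewrite !mulr_gt0.
have etad4 : eta < d4.
  by apply: le_lt_trans td4; rewrite /eta ler_pM2l// (ler_piMl (ltW m10)).
have GwC : G (xbar + t *: w) `<=` enlargement C eta.
  have cx : cball xbar d5 (xbar + t *: w).
    by rewrite /cball /closed_ball_ /= distrC xw; lra.
  move=> y /(predGe _ cx) [_ [g Gg [h Hh <-]] [_ [b bb <-] <-]].
  move: Hh; rewrite xw homH // => -[h' Hh' <-].
  apply/enlargementP => s s0.
  have /enlargementP/(_ (s / t)) [|c Cc hc] := HwC _ Hh'.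
    by rewrite divr_gt0.
  exists (g + t *: c).
    apply: convex_cone_add => //; first exact: Gxbar.
    by apply: coneC.2 => //; exact: ltW.
  have -> : g + t *: h' + (e * `|t *: w|) *: b - (g + t *: c)
      = t *: (h' - c) + (e * `|t *: w|) *: b.
    by rewrite addrAC (addrC g) addrKA -scalerBr.
  apply: le_lt_trans (ler_normD _ _) _.
  have b1 : `|b| <= 1 by move: bb; rewrite /cball /closed_ball_ /= sub0r normrN.
  have p1 : `|t *: (h' - c)| < t * e + s.
    rewrite normrZ gtr0_norm//; apply: (@lt_le_trans _ _ (t * (e' + s / t))).
      by rewrite ltr_pM2l.
    rewrite mulrDr mulrCA divff ?gt_eqF// mulr1 lerD2r ler_pM2l//.
  have p2 : `|(e * `|t *: w|) *: b| <= e * (t * m).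
    have ew : 0 <= e * `|t *: w| by rewrite mulr_ge0// ltW.
    rewrite normrZ (ger0_norm ew) (le_trans (ler_piMr ew b1))//.
    by rewrite ler_pM2l.
  by rewrite /eta; lra.
have cxw : cball xbar d4 (xbar + t *: w).
  rewrite /cball /closed_ball_ /= distrC xw (le_trans ntw)//; apply: ltW.
  by apply: le_lt_trans td4; rewrite ler_pM2l// lerDr.
have [z [Sz GzC xz]] := errb _ _ cxw Sw eta0 etad4 GwC.
(* The corrected feasible point is [z = xbar + t *: w']; [w'] remains close to [v] since the
   correction is of order [e * t]. *)
pose w' := t^-1 *: (z - xbar).
have zw' : z - xbar = t *: w' by rewrite /w' scalerKV ?gt_eqF.
have ww' : `|w - w'| <= ka * (e * (1 + m)).
  rewrite -(ler_pM2l t0) -{1}(gtr0_norm t0) -normrZ scalerBr -zw' opprB.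
  by rewrite addrCA addrA (le_trans xz)// mulrCA.
have vw' : `|v - w'| < Num.min d2 1.
  apply: le_lt_trans eM; rewrite -(subrKA w) (le_trans (ler_normD _ _))//.
  by rewrite /M; lra.
move: vw'; rewrite lt_min => /andP[vw'2 vw'1].
have w'm : `|w'| <= m.
  by rewrite -(subKr v w') (le_trans (ler_normB _ _))// lerD2l ltW.
have zm : `|z - xbar| <= t * m by rewrite zw' normrZ gtr0_norm// ler_pM2l.
have := fx z (le_lt_trans zm td3).
rewrite zw' homD// => fz.
have {}vD : `|DBf v - DBf w'| < rho / 2.
  by apply: vD; rewrite -ball_normE.
(* The rescaled decrease of [f] is close to [- DBf v = k]: half of [rho] pays for the continuity of
   [DBf], half for the remainder. *)
pose y := t^-1 *: (f xbar - f z).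
have yK : interior K y.
  have kyr : `|k - y| < rho.
    have -> : k - y = (DBf w' - DBf v) + t^-1 *: (f z - f xbar - t *: DBf w').
      rewrite [in RHS]scalerBr scalerK ?gt_eqF// [RHS]addrC addrA subrK.
      by rewrite -Dv opprK /y -[f xbar - _]opprB scalerN opprK addrC.
    apply: le_lt_trans (ler_normD _ _) _.
    rewrite distrC in vD; rewrite normrZ gtr0_norm ?invr_gt0//.
    suff : t^-1 * `|f z - f xbar - t *: DBf w'| <= rho / 2 by lra.
    rewrite mulrC ler_pdivrMr// (le_trans fz)// normrZ gtr0_norm//.
    apply: le_trans (_ : rho / (2 * m) * (t * m) <= _).
      by rewrite ler_pM2l ?divr_gt0 ?mulr_gt0// ler_pM2l.
    by rewrite le_eqVlt; apply/orP; left; apply/eqP; field; rewrite gt_eqF.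
  apply/interior_normP; exists (rho - `|k - y|) => [|u yu]; first lra.
  apply: kK; rewrite -(subrKA y) (le_lt_trans (ler_normD _ _))//; lra.
have : (f @` ([set x | S x /\ G x `<=` C] `&` cball xbar d1)
    `&` [set f xbar - k | k in interior K]) (f z).
  split.
    exists z => //; split => //.
    by rewrite /cball /closed_ball_ /= distrC; lra.
  exists (f xbar - f z); last by rewrite subKr.
  rewrite -(scalerKV (lt0r_neq0 t0) (f xbar - f z)).
  exact: interior_cone_scale.
by rewrite eff.
Qed.

(** * Total cones and separation *)

Lemma cone0 {R : realType} {V : normedModType R} {A : set V} :
  is_cone A -> A 0.
Proof. by move=> [[a Aa] /(_ 0 a (lexx 0) Aa)]; rewrite scale0r. Qed.

(** Zorn's lemma gives a maximal convex cone that contains [P] and avoids [- k]. If it missed both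
    [y] and [- y], adjoining either one would produce [- k], and a positive combination of the two
    expressions would eliminate [y]. *)
Lemma maximal_cone_total {R : realType} {V : normedModType R} {P : set V}
    {k : V} :
  is_cone P -> (forall x y, P x -> P y -> P (x + y)) -> ~ P (- k) ->
  exists M : set V, [/\ is_cone M, forall x y, M x -> M y -> M (x + y),
    P `<=` M, ~ M (- k) & forall y, M y \/ M (- y)].
Proof.
move=> coneP addP Pk.
pose good (M : set V) := [/\ is_cone M, forall x y, M x -> M y -> M (x + y),
  P `<=` M & ~ M (- k)].
(* The alternative [M = set0] accommodates chains with empty union; it is discarded afterwards,
   since [P] itself is good and nonempty. *)
have [|M [goodM maxM]] := @Zorn_bigcup V (fun M => M = set0 \/ good M).
  move=> F Fgood Ftot.
  have [[X [FX X0]]|F0] := pselect (exists X, F X /\ X <> set0); last first.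
    left; apply/seteqP; split=> // x [X FX Xx].
    by apply: F0; exists X; split=> // X0; rewrite X0 in Xx.
  right; have ok Y y : F Y -> Y y -> good Y.
    by move=> /Fgood[->|].
  have [//|[coneX _ PX _]] := Fgood _ FX.
  split=> [|x y [Y FY Yx] [W FW Wy]|x Px|[Y FY Yk]].
  - split=> [|t x t0 [Y FY Yx]]; first by exists 0, X => //; exact: cone0.
    by exists Y => //; have [[_ coneY] _ _ _] := ok _ _ FY Yx; exact: coneY.
  - have [YW|WY] := Ftot _ _ FY FW.
      by exists W => //; have [_ + _ _] := ok _ _ FW Wy; apply => //; exact: YW.
    by exists Y => //; have [_ + _ _] := ok _ _ FY Yx; apply => //; exact: WY.
  - by exists X => //; exact: PX.
  - by have [_ _ _] := ok _ _ FY Yk; apply.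
have {goodM}[coneM addM PM Mk] : good M.
  case: goodM => // M0; exfalso; apply: (maxM P); last by right; split.
  rewrite M0; split=> // /(_ 0); apply; exact: cone0.
have ext y : ~ M y -> exists a s, [/\ M a, 0 < s & - k = a + s *: y].
  move=> My; pose N := [set a + s *: y | a in M & s in [set s | 0 <= s]].
  have MN : M `<=` N.
    by move=> a Ma; exists a => //; exists 0 => //=; rewrite scale0r addr0.
  have Ny : N y.
    exists 0; first exact: cone0.
    by exists 1 => //=; rewrite scale1r add0r.
  have [[a Ma [s s0 ask]]|Nk] := pselect (N (- k)).
    exists a, s; split=> //; rewrite lt_neqAle s0 andbT eq_sym.
    apply/eqP => s00.
    by apply: Mk; rewrite -ask s00 scale0r addr0.
  exfalso; apply: (maxM N); first by split => // /(_ y Ny).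
  right; split=> //.
  - split=> [|t _ t0 [a Ma [s s0 <-]]]; first by exists y.
    rewrite scalerDr scalerA; exists (t *: a); first exact: coneM.2.
    by exists (t * s) => //=; exact: mulr_ge0.
  - move=> _ _ [a Ma [s s0 <-]] [b Mb [t t0 <-]].
    exists (a + b); first exact: addM.
    by exists (s + t); [exact: addr_ge0|rewrite scalerDl addrACA].
  - exact: subset_trans MN.
exists M; split=> // y; apply: contrapT => /not_orP[My MNy].
have [a [s [Ma s0 ka]]] := ext _ My; have [b [t [Mb t0 kb]]] := ext _ MNy.
apply: Mk; have st0 : 0 < s + t by exact: addr_gt0.
have -> : - k = (s + t)^-1 *: (t *: a + s *: b).
  apply: (scalerI (lt0r_neq0 st0)); rewrite scalerKV ?gt_eqF//.
  rewrite scalerDl {1}kb ka !scalerDr !scalerA scalerN addrACA.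
  by rewrite (mulrC t s) addNr addr0 addrC.
by apply: coneM.2; rewrite ?invr_ge0 ?ltW//; apply: addM;
  apply: coneM.2 => //; exact: ltW.
Qed.

(* With [M] a total cone containing [P] but not [- k], the functional is
   [y |-> sup {t | y - t *: k \in M}]. *)
Lemma cone_separation {R : realType} {V : normedModType R} {P : set V} {k : V} :
  is_cone P -> (forall x y, P x -> P y -> P (x + y)) -> interior P k ->
  ~ P (- k) ->
  exists q : V -> R^o, pos_polar P q /\ q k = 1.
Proof.
move=> coneP addP /interior_normP[r r0 kP] Pk.
have [M [coneM addM PM Mk Mtot]] := maximal_cone_total coneP addP Pk.
have scM t y : 0 <= t -> M y -> M (t *: y) by exact: coneM.2.
have Mk1 : M k by apply/PM/kP; rewrite subrr normr0.
have Mk_ge0 t : M (t *: k) -> 0 <= t.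
  move=> Mtk; rewrite leNgt; apply/negP => t0; apply: Mk.
  have tN0 : t != 0 by rewrite lt_eqF.
  have -> : - k = (- t)^-1 *: (t *: k).
    by rewrite invrN scaleNr scalerA mulVf// scale1r.
  by apply: scM => //; rewrite invr_ge0 oppr_ge0 ltW.
(* Interiority makes [k] an order unit for [M]; this bounds the sets [U y] and later yields
   continuity of [q]. *)
have unit t y : `|y| < r * t -> M (t *: k + y).
  move=> yt; have t0 : 0 < t by rewrite -(pmulr_rgt0 _ r0) (le_lt_trans _ yt).
  have -> : t *: k + y = t *: (k + t^-1 *: y).
    by rewrite scalerDr scalerKV ?gt_eqF.
  apply: scM; first exact: ltW.
  apply/PM/kP; rewrite opprD addNKr normrN normrZ gtr0_norm ?invr_gt0//.
  by rewrite mulrC ltr_pdivrMr.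
pose U y := [set t | M (y - t *: k)].
pose b (y : V) := (`|y| + 1) / r.
have rb y : `|y| < r * b y by rewrite mulrC divfK ?gt_eqF// ltrDl.
have ubU y s : M (s *: k - y) -> ubound (U y) s.
  move=> Ms t Ut; rewrite -subr_ge0; apply: Mk_ge0.
  by rewrite scalerBl -(subrKA y); apply: addM.
have supU y : has_sup (U y).
  split.
    by exists (- b y); rewrite /U /= scaleNr opprK addrC; exact: unit.
  by exists (b y); apply: ubU; apply: unit; rewrite normrN.
pose q y : R^o := sup (U y).
have q_ge y s : M (y - s *: k) -> s <= q y.
  by move=> Us; apply: sup_upper_bound.
have q_le y s : M (s *: k - y) -> q y <= s.
  by move=> Us; apply: ge_sup; [exact: (supU y).1|exact: ubU].
have M_lt y s : s < q y -> M (y - s *: k).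
  move=> sq; have := sq; rewrite -subr_gt0.
  move=> /sup_adherent/(_ (supU y))[t Ut]; rewrite subKr => st.
  have -> : y - s *: k = (y - t *: k) + (t - s) *: k.
    by rewrite scalerBl subrKA.
  by apply: addM => //; apply: scM => //; rewrite subr_ge0 ltW.
(* Totality of [M] enters here: above the supremum, [y - s *: k] is not in [M], so its opposite is.
   Thus [q y] is also the infimum of the [s] with [s *: k - y] in [M]. *)
have M_gt y s : q y < s -> M (s *: k - y).
  move=> qs; have [/q_ge|] := Mtot (y - s *: k); last by rewrite opprB.
  by rewrite leNgt qs.
have qD x y : q (x + y) = q x + q y.
  apply/eqP; rewrite eq_le; apply/andP; split; apply/ler_addgt0Pr => e e0.
    have e20 : 0 < e / 2 by lra.
    apply: q_le.
    have -> : q x + q y + e = (q x + e / 2) + (q y + e / 2) by lra.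
    rewrite scalerDl opprD addrACA.
    by apply: addM; apply: M_gt; rewrite ltrDl.
  rewrite -lerBlDr; apply: q_ge.
  have -> : q x + q y - e = (q x - e / 2) + (q y - e / 2) by lra.
  rewrite scalerDl opprD addrACA.
  by apply: addM; apply: M_lt; lra.
have q0 : q 0 = 0 by apply: (addIr (q 0)); rewrite -qD !add0r.
have qN x : q (- x) = - q x by apply/eqP; rewrite -addr_eq0 -qD addNr q0.
have qZp a x : 0 < a -> q (a *: x) = a * q x.
  move=> a0; apply/eqP; rewrite eq_le; apply/andP; split.
    rewrite -ler_pdivrMl//; apply/ler_addgt0Pr => e e0.
    rewrite ler_pdivrMl//; apply: q_le; rewrite -scalerA -scalerBr.
    by apply: scM; [exact: ltW|apply: M_gt; rewrite ltrDl].
  rewrite -ler_pdivlMl//; apply/ler_addgt0Pr => e e0.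
  rewrite -lerBlDr ler_pdivlMl//; apply: q_ge; rewrite -scalerA -scalerBr.
  by apply: scM; [exact: ltW|apply: M_lt; lra].
have qZ a x : q (a *: x) = a * q x.
  have [a0|a0|->] := ltgtP a 0.
  - by rewrite -[a]opprK scaleNr qN qZp ?oppr_gt0// -mulNr.
  - exact: qZp.
  - by rewrite scale0r q0 mul0r.
have qP x : P x -> 0 <= q x.
  by move=> Px; apply: q_ge; rewrite scale0r subr0; exact: PM.
exists q; split; last first.
  apply/eqP; rewrite eq_le q_le ?q_ge// scale1r subrr; exact: cone0.
split=> //; split=> [a x y|x]; first by rewrite qD qZ.
apply/cvgrPdist_le => e e0; apply/nbhs_ballP.
exists (r * e) => [|y]; first exact: mulr_gt0.
rewrite -ball_normE /= => xy; rewrite -qN -qD ler_norml; apply/andP; split.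
  by apply: q_ge; rewrite scaleNr opprK addrC; exact: unit.
by apply: q_le; apply: unit; rewrite normrN.
Qed.

(** * Fréchet derivatives, contingent cones and Hausdorff distance *)

(** Both maps approximate the increment of [f] along [t *: v] up to a small multiple of [t]; both
    are positively homogeneous, so dividing by [t] bounds their difference at [v] by any [e]. *)
Lemma B_derivative_diff {R : realType} {X Y : normedModType R} {f : X -> Y}
    {x : X} {D : X -> Y} :
  is_B_derivative f x D -> differentiable f x -> D = 'd f x.
Proof.
move=> fD df; apply/funext => v.
have [homD _ _] := fD.
apply/eqP; rewrite -subr_eq0 -normr_eq0 eq_le normr_ge0 andbT.
apply/ler_addgt0Pr => e e0; rewrite add0r.
pose c := e / (2 * (`|v| + 1)).
have v10 : 0 < `|v| + 1 by rewrite ltr_wpDl.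
have c0 : 0 < c by rewrite divr_gt0// mulr_gt0.
have [d1 d10 fx1] := B_derivative_remainder _ fD c0.
have /eqaddoP/(_ _ c0)/nbhs_ballP[d2 /= d20 fx2] := diff_locally df.
pose t := Num.min d1 d2 / (2 * (`|v| + 1)).
have d120 : 0 < Num.min d1 d2 by rewrite lt_min d10.
have t0 : 0 < t by rewrite divr_gt0// mulr_gt0.
have tv : t * `|v| < Num.min d1 d2.
  apply: (@lt_le_trans _ _ (t * (2 * (`|v| + 1)))).
    by rewrite ltr_pM2l//; lra.
  by rewrite /t divfK// gt_eqF// mulr_gt0.
move: tv; rewrite lt_min => /andP[tv1 tv2].
have ntv : `|t *: v| = t * `|v| by rewrite normrZ gtr0_norm.
have := fx2 (t *: v); have := fx1 (t *: v + x).
rewrite addrK ntv homD// => /(_ tv1) h1.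
rewrite -ball_normE /= sub0r normrN ntv => /(_ tv2).
rewrite opprD addrA.
rewrite -[X in `|X|]/(f (t *: v + x) - f x - 'd f x (t *: v)) linearZ => h2.
rewrite -(ler_pM2l t0) -{1}(gtr0_norm t0) -normrZ scalerBr.
set w := f _ - f x in h1 h2.
rewrite -(subrKA w) (le_trans (ler_normD _ _))// distrC.
have : c * (t * `|v|) <= t * (e / 2).
  rewrite mulrCA ler_pM2l// /c mulrAC ler_pdivrMr ?mulr_gt0//.
  by have := normr_ge0 v; nra.
lra.
Qed.

Lemma contingent_cone_scale {R : realType} {V : normedModType R} {A : set V}
    {x v : V} (t : R) :
  0 < t -> contingent_cone A x v -> contingent_cone A x (t *: v).
Proof.
move=> t0 [v_ [t_ [vv t_0 tt Avt]]].
exists (fun n => t *: v_ n), (fun n => t^-1 * t_ n); split.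
- exact: cvgZl_tmp.
- by move=> n; rewrite mulr_gt0 ?invr_gt0.
- by rewrite -(mulr0 t^-1); exact: cvgMl_tmp.
- by move=> n; rewrite scalerA mulrAC mulVf ?gt_eqF// mul1r.
Qed.

Lemma contingent_cone0 {R : realType} {V : normedModType R} {A : set V}
    {x : V} :
  A x -> contingent_cone A x 0.
Proof.
move=> Ax; exists (fun=> 0), (@harmonic R); split.
- exact: cvg_cst.
- by move=> n; exact: harmonic_gt0.
- exact: cvg_harmonic.
- by move=> n; rewrite scaler0 addr0.
Qed.

Lemma haus_le_enlargement {R : realType} {V : normedModType R} {A B : set V}
    {r : R} :
  (haus A B <= r%:E)%E -> A `<=` enlargement B r.
Proof.
rewrite /haus ge_max => /andP[+ _] a Aa; apply: le_trans.
by apply: ereal_sup_ubound; exists a.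
Qed.

(** * Optimality conditions and the multiplier *)

Theorem theorem4p3 (R : realType) (X Y Z : completeNormedModType R)
  (K : set Y) (C : set Z) (S : set X) (f : X -> Y) (G : X -> set Z)
  (xbar : X) (DBf : X -> Y) (HG : X -> set Z)
  (K_cone : proper_convex_cone K) (K_int : interior K !=set0)
  (C_cone : proper_convex_cone C) (C_closed : closed C)
  (C_neq0 : C <> [set 0])
  (S_neq0 : S !=set0) (S_closed : closed S)
  (G_neq0 : forall x, G x !=set0)
  (xbar_eff :
     local_weakly_efficient f K [set x | S x /\ G x `<=` C] xbar)
  (f_Bdiff : is_B_derivative f xbar DBf)
  (G_lsc : \forall x \near xbar, lsc_at G x)
  (G_incr : metrically_increasing C S G xbar)
  (G_pred : outer_prederivative G xbar HG) :
  (forall v, (upper_inverse HG C `&` weak_feasible_cone S xbar) v ->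
     ~ [set - k | k in interior K] (DBf v)) /\
  (convexlike K DBf (upper_inverse HG C `&` contingent_cone S xbar) ->
   HG 0 `<=` C ->
   haus_lipschitz HG ->
   exists ystar : Y -> R^o,
     [/\ (pos_polar K `\ 0) ystar,
         forall v, (upper_inverse HG C `&` contingent_cone S xbar) v ->
           0 <= ystar (DBf v)
       & differentiable f xbar ->
         neg_polar (upper_inverse HG C `&` contingent_cone S xbar)
           (- adjoint ('d f xbar) ystar)]).
Proof.
have [coneK cK _] := K_cone; have [coneC cC _] := C_cone.
have core v := B_derivative_notin_opp_interior _ _ _ _ _ _ _ _ v coneK coneC cC
  C_closed xbar_eff f_Bdiff G_incr G_pred.
have Cenl (r : R) : 0 <= r -> C `<=` enlargement C r.
  move=> r0 c Cc; apply/enlargementP => e e0.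
  by exists c => //; rewrite subrr normr0 ltr_wpDl.
split=> [v [HvC Sv]|DBf_conv H0C [l l0 HGlip]].
  apply: core => e e0; have [t [t0 te Sxv]] := Sv _ e0.
  exists t, v; split; rewrite ?subrr ?normr0//.
  by apply: subset_trans HvC _; apply: Cenl; exact: ltW.
set A := upper_inverse HG C `&` _ in DBf_conv *.
have Anot v : A v -> ~ [set - k | k in interior K] (DBf v).
  move=> [HvC [v_ [t_ [v_v t_0 t_cvg Sv]]]]; apply: core => e e0.
  have l10 : 0 < l + 1 by rewrite ltr_wpDl.
  (* Dividing by [l + 1] rather than [l] covers [l = 0] and also makes [v_ n] closer to [v] than
     [e]. *)
  have el0 : 0 < e / (l + 1) by exact: divr_gt0.
  have [n [vn tn]] : exists n, `|v - v_ n| < e / (l + 1) /\ t_ n < e.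
    near \oo => n; exists n; split; near: n.
      by move/cvgrPdist_lt : v_v; exact.
    by apply: cvgr_lt t_cvg _ e0.
  exists (t_ n), (v_ n); split=> //.
    by apply: lt_le_trans vn _; rewrite ler_pdivrMr// ler_peMr ?lerDr// ltW.
  move=> h /(haus_le_enlargement (HGlip (v_ n) v)) /enlargementP hH.
  apply/enlargementP => s s0; have [c Hc hc] := hH _ s0.
  exists c; first exact: HvC.
  apply: lt_le_trans hc _; rewrite lerD2r distrC.
  move: vn; rewrite ltr_pdivlMr// mulrDr mulr1 => vn.
  by have := normr_ge0 (v - v_ n); lra.
have D0 := B_derivative0 f_Bdiff; have [homD cD _] := f_Bdiff.
have A0 : A 0.
  by split=> //; apply: contingent_cone0; have [[]] := xbar_eff.
have AZ t v : 0 < t -> A v -> A (t *: v).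
  move=> t0 [HvC Tv]; split; last exact: contingent_cone_scale.
  rewrite /upper_inverse /= (G_pred.1 _ _ t0) => _ [h Hh <-].
  by apply: coneC.2; [exact: ltW|exact: HvC].
(* [P] is convex by convexlikeness and a cone by homogeneity of [DBf] and [A]; adding [K] gives it
   interior points. *)
pose P := set_add (DBf @` A) K.
have coneP : is_cone P.
  split=> [|t _ t0 [_ [v Av <-] [k Kk <-]]].
    by exists (DBf 0 + 0), (DBf 0); [exists 0|exists 0 => //; exact: cone0].
  move: t0; rewrite le_eqVlt => /predU1P[<-|t0].
    exists (DBf 0); first by exists 0.
    by exists 0; [exact: cone0|rewrite D0 addr0 scale0r].
  exists (DBf (t *: v)); first by exists (t *: v) => //; exact: AZ.
  exists (t *: k); first by apply: coneK.2 => //; exact: ltW.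
  by rewrite homD// scalerDr.
have KP : K `<=` P.
  by move=> k Kk; exists 0; [exists 0|exists k; rewrite ?add0r].
have [k0 Kk0] := K_int.
have Pk0 : interior P k0 by exact: interiorS Kk0.
(* If [- k0 = DBf v + k], then [DBf v] is the opposite of [k0 + k], which is interior to [K]. *)
have PNk0 : ~ P (- k0).
  move=> [_ [v Av <-] [k Kk vk]]; apply: (Anot v Av); exists (k0 + k).
    exact: interior_cone_add.
  by rewrite opprD -vk addrK.
have [q [[dualq qP] qk0]] := cone_separation coneP
  (fun x y => convex_cone_add x y coneP DBf_conv) Pk0 PNk0.
have qA v : A v -> 0 <= q (DBf v).
  move=> Av; apply: qP; exists (DBf v); first by exists v.
  by exists 0; [exact: cone0|rewrite addr0].
exists q; split=> //.
  split; first by split=> // k /KP /qP.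
  by move=> q0; have := oner_neq0 R; rewrite -qk0 q0 /= eqxx.
move=> df; exists (adjoint ('d f xbar) q) => //.
have [linq contq] := dualq.
(* As [DBf] is the differential, linearity is taken from the latter, continuity and sign from the
   former. *)
rewrite /adjoint -(B_derivative_diff f_Bdiff df); split=> //; split.
  move=> a x y /=; rewrite (B_derivative_diff f_Bdiff df) linearP.
  by rewrite linq.
by move=> x; apply: continuous_comp; [exact: cD|exact: contq].
Unshelve. all: by end_near. Qed.
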